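(* Let $q$ be a prime power and let $n$ be a positive integer. Let $r \in \mathbb{N}$ be a divisor of $q^n-1$ and let $f \in \mathbb{F}_q[x]$ be a monic divisor of $x^n-1$ of degree $k$. If $$q^{\frac{n}{2}-k} \geq r\, W(q^n-1)\, W\!\left(\frac{x^n-1}{f}\right),$$ then there exists an element of $\mathbb{F}_{q^n}$ which is both $r$-primitive and $k$-normal over $\mathbb{F}_q$.
   Context: $\mathbb{F}_{q^n}$ is the finite field with $q^n$ elements. For a positive integer $t$, $W(t)$ is the number of square-free (positive) divisors of $t$; for a monic polynomial $t \in \mathbb{F}_q[x]$, $W(t)$ is the number of monic square-free divisors of $t$ in $\mathbb{F}_q[x]$. For a divisor $r$ of $q^n-1$, an element $\alpha \in \mathbb{F}_{q^n}^*$ is $r$-primitive if its multiplicative order is $(q^n-1)/r$. An element $\alpha \in \mathbb{F}_{q^n}$ is $k$-normal over $\mathbb{F}_q$ (where $0\le k\le n-1$) if the greatest common divisor in $\mathbb{F}_{q^n}[x]$ of $x^n-1$ and $g_\alpha(x)=\sum_{i=0}^{n-1}\alpha^{q^i}x^{n-1-i}$ has degree $k$. *)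

(* Defs.v *)
From mathcomp Require Import all_boot all_order all_algebra all_field.
From mathcomp Require Import boolp reals exp.
Set Implicit Arguments.
Unset Strict Implicit.
Unset Printing Implicit Defensive.
Import GRing.Theory Num.Theory.
Local Open Scope ring_scope.

Definition squarefree_nat (m : nat) : Prop :=
  forall d : nat, (d ^ 2 %| m)%N -> d = 1%N.

Definition squarefree_poly (F : fieldType) (p : {poly F}) : Prop :=
  forall d : {poly F}, d ^+ 2 %| p -> d \is a GRing.unit.

Definition W_nat (t : nat) : nat :=
  count (fun d => `[< squarefree_nat d >]) (divisors t).

(* For t != 0, every divisor of t lies in the finite type
   {poly_(size t) F} of polynomials of size at most size t. *)
Definition W_poly (F : finFieldType) (t : {poly F}) : nat :=
  #|[set d : {poly_(size t) F} |
      [&& (d : {poly F}) \is monic, (d : {poly F}) %| t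
        & `[< squarefree_poly (d : {poly F}) >]]]|.

(* m.-primitive_root a says that a has multiplicative order exactly m > 0;
   in particular a is nonzero. *)
Definition r_primitive (F : finFieldType) (L : fieldExtType F)
    (r : nat) (a : L) : bool :=
  (r %| #|F| ^ \dim {:L} - 1)%N
  && (((#|F| ^ \dim {:L} - 1) %/ r)%N).-primitive_root a.

Definition g_poly (F : finFieldType) (L : fieldExtType F) (a : L) : {poly L} :=
  \sum_(0 <= i < \dim {:L}) a ^+ (#|F| ^ i) *: 'X^(\dim {:L} - 1 - i).

(* gcdp is the gcd up to a nonzero constant; here it is nonzero, so that
   its degree is (size _).-1. *)
Definition k_normal (F : finFieldType) (L : fieldExtType F)
    (k : nat) (a : L) : bool :=
  (k < \dim {:L})%N && (size (gcdp ('X^(\dim {:L}) - 1) (g_poly a)) == k.+1).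

(* Main.v *)
From HB Require Import structures.
Require Import Defs.
From mathcomp Require Import all_boot all_order all_fingroup all_algebra.
From mathcomp Require Import all_solvable all_field classfun character.
From mathcomp Require Import archimedean boolp reals exp ring zify.
Set Implicit Arguments.
Unset Strict Implicit.
Unset Printing Implicit Defensive.
Import Order.TTheory GRing.Theory Num.Theory FinRing.Theory GroupScope.
Local Open Scope ring_scope.

(** Put [N = q^n - 1], [M = N / r] and [h = (X^n - 1) / f].  Let [F[X]] act on
    [L] by letting [X] act as the Frobenius map [x |-> x^q]; the action of [g] is
    the linearized polynomial [linpoly g].  An element [a] of [L] is
    - [r]-primitive as soon as [a^M = 1] and [a^(M/l) <> 1] for every prime
      [l | M] ([prim_root_of_order]);
    - [k]-normal as soon as [a] is annihilated by [h], but by no [h / p] with [p]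
      a monic irreducible factor of [h] ([k_normal_linpoly_ker]).  The reason is
      that, modulo [X^n - 1], multiplying [g_poly a] by [w] in [F[X]] gives
      [g_poly (linpoly w a)].  As [X * g_poly a] is congruent to
      [g_poly (a^q)], the gcd of [X^n - 1] and [g_poly a] is invariant under
      Frobenius, hence has an associate in [F[X]]; that associate is [f].

    Both conditions say that [a] lies in a subgroup [V0] of a finite abelian
    group [G] (the units of [L], resp. its additive group) but in none of
    finitely many subgroups [V i] of [V0], which are independent in the sense
    that the index of an intersection of some of them is the product of their
    indices.  In this situation there is a function [phi] on [G], supported on
    those elements, with principal Fourier coefficient [1] and with all the
    other coefficients adding up in absolute value to at most
    [|G : V0| * 2^|I| - 1].  Indeed, with [c i = |V0 : V i|], let [phi] be
    [|G : V0| 1_V0 * prod_i (1 - (c i 1_(V i) - 1_V0) / (c i - 1))].  Once the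
    product is expanded, each of the [2^|I|] terms is, up to sign, a function
    with nonnegative Fourier coefficients taking the value [|G : V0|] at the
    identity, and this value is the sum of those coefficients
    ([cfdot_sieve_cfun1], [sieve_cfun_norm]).

    If no element satisfied both conditions, the product of the two functions
    would vanish on the units, and so would its sum.  Expanding this sum in
    characters gives a main term [q^n - 1] and Gauss sums: those with exactly
    one nontrivial character equal [0] or [-1], those with two nontrivial
    characters have absolute value [q^(n/2)].  For
    [A = r * 2^(number of primes l | M)] and
    [B = q^k * 2^(number of irreducible p | h)] this is absurd as soon as
    [A * B <= q^(n/2)] ([common_support]).  The hypothesis of the theorem implies
    this bound, because products of distinct primes are squarefree divisors
    ([W_nat_ge], [W_poly_ge]). *)

(** * Positive definite functions on finite abelian groups *)

Section PosDef.

Variables (gT : finGroupType) (G : {group gT}).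
Hypothesis abelG : abelian G.
Implicit Types (phi psi : 'CF(G)) (H K : {group gT}).

(** Fourier coefficients are all nonnegative; by Bochner's theorem this is
    positive definiteness. *)
Definition posdef phi := forall i, 0 <= '[phi, 'chi_i].

Lemma irr_abel_lin_char (i : Iirr G) : 'chi_i \is a linear_char.
Proof. by apply/char_abelianP. Qed.

Lemma sub_abel_normal H : H \subset G -> H <| G.
Proof. by move=> sHG; rewrite -sub_abelian_normal. Qed.

Lemma cfuni_abelE H x : H \subset G -> ('1_H : 'CF(G)) x = (x \in H)%:R.
Proof. by move/sub_abel_normal/cfuniE. Qed.

Lemma posdefM phi psi : posdef phi -> posdef psi -> posdef (phi * psi).
Proof.
move=> pphi ppsi k; rewrite {1}[phi]cfun_sum_cfdot {1}[psi]cfun_sum_cfdot.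
rewrite mulr_suml cfdot_suml sumr_ge0 // => i _.
rewrite mulr_sumr cfdot_suml sumr_ge0 // => j _.
rewrite -scalerAl -scalerAr scalerA cfdotZl; apply: mulr_ge0.
  exact: mulr_ge0.
by apply: natr_ge0; rewrite Cnat_cfdot_char ?rpredM ?irr_char.
Qed.

Lemma posdefZ (c : algC) phi : 0 <= c -> posdef phi -> posdef (c *: phi).
Proof. by move=> c0 pphi i; rewrite cfdotZl mulr_ge0. Qed.

Lemma posdef1 : posdef 1.
Proof. by move=> i; rewrite -irr0 cfdot_irr ler0n. Qed.

Lemma posdef_prod (I : finType) (P : pred I) (F : I -> 'CF(G)) :
  (forall i, P i -> posdef (F i)) -> posdef (\prod_(i | P i) F i).
Proof. by move=> pF; apply: big_ind => //; [exact: posdef1 | exact: posdefM]. Qed.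

Lemma cfdot_cfuni_irr H (i : Iirr G) : H \subset G ->
  '['1_H, 'chi_i] = #|H|%:R / #|G|%:R * ('Res[H] 'chi_i == 1)%:R.
Proof.
move=> sHG; have linR := cfRes_lin_char H (irr_abel_lin_char i).
have ->: '['1_H, 'chi_i] = #|H|%:R / #|G|%:R * '[1, 'Res[H] 'chi_i].
  rewrite (cfdotEl _ (cfuni_on _ _)) cfdotE [RHS]mulrA.
  rewrite [_ / _ / _]mulrAC mulfV ?neq0CG // mul1r.
  congr (_ * _); apply: eq_bigr => x Hx.
  by rewrite cfuni_abelE // Hx cfun1E Hx cfResE.
congr (_ * _); have [j ->] := irrP (lin_char_irr linR).
by rewrite -irr0 cfdot_irr eq_sym (inj_eq irr_inj).
Qed.

(** The function below vanishes off [K], and on [K] it is the sum of the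
    nontrivial characters of [K / H]. *)
Lemma posdef_cfuniB H K : H \subset K -> K \subset G ->
  posdef (#|K : H|%:R *: '1_H - '1_K).
Proof.
move=> sHK sKG i; have sHG := subset_trans sHK sKG.
rewrite cfdotBl cfdotZl !cfdot_cfuni_irr // 2!mulrA -natrM mulnC Lagrange //.
rewrite -mulrBr mulr_ge0 ?divr_ge0 ?ler0n // subr_ge0 ler_nat.
have [Ki|] := eqVneq ('Res[K] _) 1; last by rewrite leq0n.
by rewrite -(cfResRes _ sHK sKG) Ki cfRes_cfun1 // eqxx.
Qed.

Lemma posdef_cfuni H : H \subset G -> posdef '1_H.
Proof. by move=> sHG i; rewrite cfdot_cfuni_irr // mulr_ge0 ?divr_ge0 ?ler0n. Qed.

(** Linear characters take the value [1] at the identity, so the value there of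
    a positive definite function is the sum of its Fourier coefficients. *)
Lemma posdef_sum_norm phi : posdef phi -> \sum_i `|'[phi, 'chi_i]| = phi 1%g.
Proof.
move=> pphi; rewrite {2}[phi]cfun_sum_cfdot sum_cfunE.
by apply: eq_bigr => i _; rewrite cfunE lin_char1 ?irr_abel_lin_char // mulr1 ger0_norm.
Qed.

End PosDef.

(** * Sieving by independent subgroups *)

Section Sieve.

Variables (gT : finGroupType) (G V0 : {group gT}).
Variables (I : finType) (V : I -> {group gT}).
Hypothesis abelG : abelian G.
Hypothesis sV0G : V0 \subset G.
Hypothesis sVV0 : forall i, V i \subset V0.
Hypothesis index_gt1 : forall i, (1 < #|V0 : V i|)%N.
Hypothesis index_cap : forall S : {set I},
  (#|V0 :&: \bigcap_(i in S) V i| * \prod_(i in S) #|V0 : V i|)%N = #|V0|.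

Local Notation c i := (#|V0 : V i|%:R : algC).

(** On [V0], [1 - sieve_factor i] is proportional to the indicator of the
    complement of [V i], and [sieve_factor i] is positive definite with value [1]
    at the identity. *)
Definition sieve_factor i : 'CF(G) :=
  (c i - 1)^-1 *: (c i *: '1_(V i) - '1_V0).

(** A function supported on the elements of [V0] outside every [V i]; the factor
    [#|G : V0|] normalizes its principal Fourier coefficient to [1]. *)
Definition sieve_cfun : 'CF(G) :=
  #|G : V0|%:R *: '1_V0 * \prod_i (1 - sieve_factor i).

Let sVG i : V i \subset G := subset_trans (sVV0 i) sV0G.
Let c1_gt0 i : 0 < c i - 1.
Proof. by rewrite subr_gt0 ltr1n. Qed.

Lemma sieve_factorE i x : x \in V0 ->
  1 - sieve_factor i x = (1 - (c i)^-1)^-1 * (1 - (x \in V i)%:R).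
Proof.
move=> V0x; rewrite !cfunE !cfuni_abelE // V0x.
have c_neq0 : c i != 0 by rewrite pnatr_eq0 -lt0n.
have c1_neq0 : c i - 1 != 0 by rewrite gt_eqF.
by rewrite mulr1n; field; rewrite c_neq0 c1_neq0.
Qed.

Lemma sieve_cfunE x : x \in V0 ->
  sieve_cfun x = #|G : V0|%:R * (\prod_i (1 - (c i)^-1)^-1) *
                 \prod_i (1 - (x \in V i)%:R).
Proof.
move=> V0x; have Gx := subsetP sV0G x V0x.
rewrite /sieve_cfun !cfunE cfuni_abelE // V0x mulr1 prod_cfunE // -mulrA.
rewrite -big_split /=; congr (_ * _); apply: eq_bigr => i _.
by rewrite -(sieve_factorE i V0x) 2!cfunE cfun1E Gx.
Qed.

Lemma sieve_cfun_supp x : sieve_cfun x != 0 ->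
  x \in V0 /\ forall i, x \notin V i.
Proof.
move=> nz; have V0x : x \in V0.
  apply: contraNT nz => /negPf V0x.
  by rewrite /sieve_cfun !cfunE cfuni_abelE // V0x mulr0 mul0r.
split=> // i; apply: contraNN nz => Vix.
by rewrite sieve_cfunE // [X in _ * X](bigD1 i) //= Vix subrr mul0r mulr0.
Qed.

Lemma cfdot_sieve_cfun1 : '[sieve_cfun, 'chi_0] = 1.
Proof.
have sup : sieve_cfun \in 'CF(G, V0).
  apply/cfun_onP=> x V0x; apply/eqP; apply: contraNT V0x.
  by case/sieve_cfun_supp.
rewrite irr0 (cfdotEl _ sup).
pose K : algC := \prod_i (1 - (c i)^-1)^-1.
(* The product of the complementary indicators is expanded over the subsets of
   [I], so that only cardinals of intersections are needed. *)
have expand x : x \in V0 -> sieve_cfun x * ((1 : 'CF(G)) x)^* =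
    #|G : V0|%:R * K * \sum_(S : {set I})
      \prod_(i in S) (-1) * (x \in \bigcap_(i in S) V i)%:R.
  move=> V0x; rewrite cfun1E (subsetP sV0G) // rmorph1 mulr1 sieve_cfunE //.
  congr (_ * _).
  under eq_bigr do rewrite addrC.
  rewrite bigA_distr; apply: eq_bigr => S _.
  rewrite -big_mkcond /=; under eq_bigr do rewrite -mulN1r.
  rewrite big_split /=; congr (_ * _).
  have [/bigcapP xS | xS] := boolP (x \in _).
    by apply: big1 => i Si; rewrite xS.
  move: xS; rewrite -in_setC setC_bigcap => /bigcupP[i Si].
  by rewrite inE => /negPf Vix; rewrite (bigD1 i) //= Vix mul0r.
rewrite (eq_bigr _ expand) -mulr_sumr exchange_big /=.
have sumS (S : {set I}) :
    \sum_(x in V0) \prod_(i in S) (-1) * (x \in \bigcap_(i in S) V i)%:R =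
    #|V0|%:R * \prod_(i in S) (- (c i)^-1).
  rewrite -mulr_sumr -natr_sum -big_mkcondr.
  rewrite (eq_bigl (mem (V0 :&: \bigcap_(i in S) V i))); last first.
    by move=> x; rewrite !inE.
  rewrite sum1_card -(index_cap S) natrM natr_prod -mulrA -big_split /=.
  rewrite mulrC; congr (_ * _); apply: eq_bigr => i _.
  by rewrite mulrN mulfV // pnatr_eq0 -lt0n.
rewrite (eq_bigr _ (fun S _ => sumS S)) -mulr_sumr.
have -> : \sum_(S : {set I}) \prod_(i in S) (- (c i)^-1) =
          \prod_i (1 - (c i)^-1).
  under [RHS]eq_bigr do rewrite addrC.
  by rewrite bigA_distr; apply: eq_bigr => S _; rewrite -big_mkcond.
have KP : K * \prod_i (1 - (c i)^-1) = 1.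
  rewrite -big_split big1 //= => i _; rewrite mulVf // subr_eq0 eq_sym.
  by rewrite invr_eq1 gt_eqF // ltr1n.
rewrite -(Lagrange sV0G) natrM.
set P := \prod_i _ in KP *.
by rewrite mulrACA [_ * _%:R]mulrC KP mulr1 mulVf // mulf_neq0 ?pnatr_eq0 -?lt0n.
Qed.

Lemma sieve_cfun_norm :
  \sum_(i | i != 0) `|'[sieve_cfun, 'chi_i]| <= (#|G : V0| * 2 ^ #|I|)%:R - 1.
Proof.
have pf i : posdef (sieve_factor i).
  apply: posdefZ; first by rewrite invr_ge0 ltW.
  exact: posdef_cfuniB.
(* Up to sign, the summand of index [S] in the expanded product. *)
pose E (S : {set I}) : 'CF(G) :=
  #|G : V0|%:R *: '1_V0 * \prod_(i in S) sieve_factor i.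
have pE S : posdef (E S).
  apply: posdefM; first by apply: posdefZ; [exact: ler0n | exact: posdef_cfuni].
  by apply: posdef_prod => i _.
have E1 S : E S 1%g = #|G : V0|%:R.
  rewrite /E !cfunE cfuni_abelE // group1 mulr1 prod_cfunE // big1 ?mulr1 // => i _.
  by rewrite !cfunE !cfuni_abelE // !group1 mulr1 mulVf // gt_eqF.
have sE : sieve_cfun = \sum_(S : {set I}) (\prod_(i in S) (-1)) *: E S.
  rewrite /sieve_cfun; under [\prod_i _]eq_bigr do rewrite addrC.
  rewrite bigA_distr mulr_sumr; apply: eq_bigr => S _.
  rewrite -big_mkcond /E scalerAr; congr (_ * _).
  under eq_bigr do rewrite -scaleN1r.
  by rewrite scaler_prod.
have tot : \sum_i `|'[sieve_cfun, 'chi_i]| <= (#|G : V0| * 2 ^ #|I|)%:R.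
  apply: (@le_trans _ _ (\sum_i \sum_(S : {set I}) `|'[E S, 'chi_i]|)).
    apply: ler_sum => i _; rewrite sE cfdot_suml.
    apply: le_trans (ler_norm_sum _ _ _) _; apply: ler_sum => S _.
    rewrite cfdotZl normrM normr_prod big1 ?mul1r // => j _.
    by rewrite normrN1.
  rewrite exchange_big /=.
  rewrite (eq_bigr (fun=> #|G : V0|%:R)); last first.
    by move=> S _; rewrite posdef_sum_norm.
  by rewrite sumr_const -cardsT -powersetT card_powerset cardsT natrM mulr_natr.
by move: tot; rewrite (bigD1 0) //= cfdot_sieve_cfun1 normr1 -lerBrDl.
Qed.

End Sieve.

(** * Gauss sums over finite fields *)

Section Gauss.

Variable E : finFieldType.
Local Notation U := [set: {unit E}]%G.
Local Notation A := [set: E]%G.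

Lemma unit_abelian : abelian U.
Proof. by apply/centsP=> x _ y _; apply/val_inj; rewrite /= mulrC. Qed.

Lemma add_abelian : abelian A.
Proof. exact: zmod_abelian. Qed.

Lemma add_charD (j : Iirr A) (x y : E) :
  'chi_j (x + y) = 'chi_j x * 'chi_j y.
Proof. by rewrite -zmodMgE lin_charM ?inE ?irr_abel_lin_char ?add_abelian. Qed.

Lemma add_charN (j : Iirr A) (x : E) : 'chi_j (- x) = ('chi_j x)^*.
Proof. by rewrite -zmodVgE lin_charV_conj ?inE ?irr_abel_lin_char ?add_abelian. Qed.

Lemma sum_irr0 (gT : finGroupType) (G : {group gT}) (i : Iirr G) :
  i != 0 -> \sum_(x in G) 'chi_i x = 0.
Proof.
move=> nz_i; have := cfdot_irr i 0; rewrite (negPf nz_i) irr0 cfdotE.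
move/eqP; rewrite mulf_eq0 invr_eq0 (negPf (neq0CG _)) /= => /eqP S0; rewrite -[RHS]S0.
by apply: eq_bigr => x Gx; rewrite cfun1E Gx rmorph1 mulr1.
Qed.

Lemma sum_unit_add_char (j : Iirr A) (c : E) : j != 0 -> c != 0 ->
  \sum_(u : {unit E}) 'chi_j (FinRing.uval u * c) = -1.
Proof.
move=> nz_j nz_c; have := sum_irr0 nz_j.
rewrite (eq_bigl xpredT); last by move=> x; rewrite inE.
rewrite (reindex (fun x : E => x * c)) /=; last first.
  by exists (fun x => x / c) => x _; rewrite ?mulfK ?divfK.
rewrite (bigD1 0) //= mul0r lin_char1 ?irr_abel_lin_char ?add_abelian // => /eqP.
rewrite addrC addr_eq0 => /eqP <-.
(* The nonzero elements are the values of the units; the default value of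
   [insubd] is immaterial. *)
symmetry; rewrite (reindex_onto (@FinRing.uval E) (insubd (1%g : {unit E}))) /=.
  apply: eq_bigl => u; rewrite -unitfE (valP u).
  by apply/eqP/val_inj; rewrite val_insubd (valP u).
by move=> x nz_x; rewrite val_insubd unitfE nz_x.
Qed.

(** The Gauss sum of a multiplicative and an additive character. *)
Definition gauss_sum (i : Iirr U) (j : Iirr A) : algC :=
  \sum_(u : {unit E}) 'chi_i u * 'chi_j (FinRing.uval u).

(** In the double sum for the squared norm, substituting [u = v * w] isolates
    complete sums of the additive character over the units. *)
Lemma gauss_sum_norm i j : i != 0 -> j != 0 ->
  `|gauss_sum i j| ^+ 2 = #|E|%:R.
Proof.
move=> nz_i nz_j; rewrite normCK /gauss_sum rmorph_sum mulr_suml.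
have sumE u : 'chi_i u * 'chi_j (FinRing.uval u) *
    (\sum_(v : {unit E}) ('chi_i v * 'chi_j (FinRing.uval v))^*) =
  \sum_(v : {unit E})
     'chi_i (v^-1 * u)%g * 'chi_j (FinRing.uval u - FinRing.uval v).
  rewrite mulr_sumr; apply: eq_bigr => v _.
  have lin_i := irr_abel_lin_char unit_abelian i.
  rewrite rmorphM /= mulrACA add_charD add_charN lin_charM ?inE //.
  by rewrite lin_charV_conj ?inE // ['chi_i u * _]mulrC.
rewrite (eq_bigr _ (fun u _ => sumE u)) exchange_big /=.
have sumv v :
    \sum_u 'chi_i (v^-1 * u)%g * 'chi_j (FinRing.uval u - FinRing.uval v) =
    \sum_w 'chi_i w * 'chi_j (FinRing.uval v * (FinRing.uval w - 1)).
  rewrite (reindex_inj (mulgI v)); apply: eq_bigr => w _.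
  by rewrite mulKg mulrBr mulr1.
rewrite (eq_bigr _ (fun v _ => sumv v)) exchange_big /=.
under eq_bigr do rewrite -mulr_sumr.
rewrite (bigD1 1%g) //= lin_char1 ?irr_abel_lin_char ?unit_abelian // mul1r subrr.
have -> : \sum_(v : {unit E}) 'chi_j (FinRing.uval v * 0) = #|[set: {unit E}]|%:R.
  under eq_bigr do rewrite mulr0 lin_char1 ?irr_abel_lin_char ?add_abelian //.
  by rewrite sumr_const cardsT.
rewrite (eq_bigr (fun w => - 'chi_i w)); last first.
  move=> w nz_w; rewrite sum_unit_add_char ?mulrN1 // subr_eq0.
  by rewrite -(inj_eq val_inj) in nz_w.
have := sum_irr0 nz_i.
rewrite (bigD1 1%g) ?inE //= lin_char1 ?irr_abel_lin_char ?unit_abelian // => /eqP.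
rewrite addrC addr_eq0 sumrN => /eqP E1.
rewrite (eq_bigl (fun w => (w \in U) && (w != 1%g))) ?E1; last first.
  by move=> w; rewrite inE.
rewrite opprK card_finField_unit natr1 prednK //.
by apply/card_gt0P; exists 0.
Qed.

Lemma gauss_sum_le i j : i != 0 -> j != 0 ->
  `|gauss_sum i j| <= sqrtC #|E|%:R.
Proof.
move=> nz_i nz_j; rewrite -(gauss_sum_norm nz_i nz_j).
by rewrite sqrCK ?normr_ge0.
Qed.

Lemma gauss_sum0l j : j != 0 -> gauss_sum 0 j = -1.
Proof.
move=> nz_j; rewrite -(sum_unit_add_char nz_j (oner_neq0 E)).
by apply: eq_bigr => u _; rewrite irr0 cfun1E inE mul1r mulr1.
Qed.

Lemma gauss_sum0r i : i != 0 -> gauss_sum i 0 = 0.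
Proof.
move=> nz_i; rewrite -[RHS](sum_irr0 nz_i).
rewrite [RHS](eq_bigl xpredT); last by move=> x; rewrite inE.
by apply: eq_bigr => u _; rewrite irr0 cfun1E inE mulr1.
Qed.

Lemma gauss_sum00 : gauss_sum 0 0 = #|E|%:R - 1.
Proof.
transitivity (\sum_(u in U) (1 : algC)).
  rewrite [RHS](eq_bigl xpredT); last by move=> x; rewrite inE.
  by apply: eq_bigr => u _; rewrite !irr0 !cfun1E !inE mulr1.
rewrite sumr_const card_finField_unit -subn1 natrB //.
by apply/card_gt0P; exists 0.
Qed.

Lemma sum_mul_cfun (phi : 'CF(U)) (psi : 'CF(A)) :
  \sum_(u : {unit E}) phi u * psi (FinRing.uval u) =
  \sum_i \sum_j '[phi, 'chi_i] * '[psi, 'chi_j] * gauss_sum i j.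
Proof.
have expand u : phi u * psi (FinRing.uval u) = \sum_i \sum_j
    '[phi, 'chi_i] * '[psi, 'chi_j] * ('chi_i u * 'chi_j (FinRing.uval u)).
  rewrite {1}[phi]cfun_sum_cfdot {1}[psi]cfun_sum_cfdot !sum_cfunE mulr_suml.
  apply: eq_bigr => i _; rewrite mulr_sumr; apply: eq_bigr => j _.
  by rewrite !cfunE mulrACA.
rewrite (eq_bigr _ (fun u _ => expand u)) exchange_big; apply: eq_bigr => i _.
by rewrite exchange_big; apply: eq_bigr => j _; rewrite mulr_sumr.
Qed.

(** The sum of the products [phi u * psi u] has main term [|E| - 1]; with
    [s = sqrt |E|], the other terms add up to at most
    [(b - 1) + (a - 1) * (b - 1) * s], which is less as [a * b <= s]. *)
Lemma common_support (phi : 'CF(U)) (psi : 'CF(A)) (a b : nat) :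
  (0 < a)%N -> (0 < b)%N -> ((a * b) ^ 2 <= #|E|)%N ->
  '[phi, 'chi_0] = 1 -> '[psi, 'chi_0] = 1 ->
  \sum_(i | i != 0) `|'[phi, 'chi_i]| <= a%:R - 1 ->
  \sum_(j | j != 0) `|'[psi, 'chi_j]| <= b%:R - 1 ->
  exists u : {unit E}, phi u != 0 /\ psi (FinRing.uval u) != 0.
Proof.
move=> a_gt0 b_gt0 le_ab phi0 psi0 phi_le psi_le.
pose s : algC := sqrtC #|E|%:R.
have s_ge0 : 0 <= s by rewrite sqrtC_ge0 ler0n.
have ss : s * s = #|E|%:R by rewrite -expr2 sqrtCK.
have le_abs : a%:R * b%:R <= s.
  rewrite -(@ler_pXn2r _ 2) ?nnegrE ?mulr_ge0 ?ler0n //.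
  by rewrite [s ^+ 2]expr2 ss -natrM -natrX ler_nat.
have s_gt1 : 1 < s.
  rewrite -(@ltr_pXn2r _ 2) ?nnegrE ?ler01 // expr1n [s ^+ 2]expr2 ss ltr1n.
  exact: finNzRing_gt1.
have [/existsP[u /andP[]] | /existsPn no_u] :=
  boolP [exists u : {unit E}, (phi u != 0) && (psi (FinRing.uval u) != 0)].
  by exists u.
(* Otherwise the sum of the products vanishes, and so does its expansion in
   Gauss sums. *)
have := sum_mul_cfun phi psi.
rewrite big1; last first.
  move=> u _; apply/eqP; rewrite mulf_eq0; have := no_u u.
  by rewrite negb_and !negbK.
rewrite (bigD1 0) //= (bigD1 0) //= phi0 psi0 !mul1r gauss_sum00.
rewrite (eq_bigr (fun j => - '[psi, 'chi_j])); last first.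
  by move=> j nz_j; rewrite gauss_sum0l // mul1r mulrN1.
rewrite sumrN [X in _ + X](eq_bigr (fun i => \sum_(j | j != 0)
   '[phi, 'chi_i] * '[psi, 'chi_j] * gauss_sum i j)); last first.
  by move=> i nz_i; rewrite (bigD1 0) //= gauss_sum0r // mulr0 add0r.
set P := \sum_(j | _) _; set Q := \sum_(i | _) _ => E0.
have leP : `|P| <= b%:R - 1 by apply: le_trans (ler_norm_sum _ _ _) psi_le.
have leQ : `|Q| <= (a%:R - 1) * (b%:R - 1) * s.
  apply: le_trans (ler_norm_sum _ _ _) _.
  apply: (@le_trans _ _ ((\sum_(i | i != 0) `|'[phi, 'chi_i]|) *
     (\sum_(j | j != 0) `|'[psi, 'chi_j]|) * s)); last first.
    by apply: ler_wpM2r => //; apply: ler_pM => //; apply: sumr_ge0.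
  rewrite !mulr_suml; apply: ler_sum => i nz_i.
  apply: le_trans (ler_norm_sum _ _ _) _.
  rewrite mulr_sumr mulr_suml; apply: ler_sum => j nz_j.
  by rewrite !normrM ler_wpM2l ?mulr_ge0 // gauss_sum_le.
have EQ : s * s - 1 = P - Q by rewrite ss -[LHS]subr0 E0; ring.
have : s * s - 1 <= b%:R - 1 + (a%:R - 1) * (b%:R - 1) * s.
  have -> : s * s - 1 = `|P - Q|.
    rewrite -EQ ger0_norm // subr_ge0 -[1]mulr1.
    by apply: ler_pM => //; apply: ltW.
  by apply: le_trans (ler_normB _ _) _; apply: lerD.
(* It contradicts [b + (a - 1) * (b - 1) * s < b * s + (a - 1) * (b - 1) * s] and
   [b + (a - 1) * (b - 1) <= a * b <= s]. *)
rewrite addrAC lerD2r lt_geF //.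
apply: (@lt_le_trans _ _ (b%:R * s + (a%:R - 1) * (b%:R - 1) * s)).
  by rewrite ltrD2r ltr_pMr // ltr0n.
rewrite -mulrDl ler_wpM2r // (le_trans _ le_abs) //.
have -> : b%:R + (a%:R - 1) * (b%:R - 1) = a%:R * b%:R - (a%:R - 1) :> algC by ring.
by rewrite gerBl subr_ge0 ler1n.
Qed.

End Gauss.

(** * Monic irreducible factors of polynomials *)

Section IrreducibleFactors.

Variable F : fieldType.
Implicit Types p g h d : {poly F}.

Lemma size1_poly_unit d : size d = 1%N -> d \is a GRing.unit.
Proof.
by move/eqP/size_poly1P=> [c nz_c ->]; rewrite poly_unitE size_polyC nz_c coefC unitfE.
Qed.

Lemma irr_coprimep_ndvdp p d : irreducible_poly p ->
  coprimep p d = ~~ (p %| d).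
Proof.
move=> irr_p; apply/idP/negP => [cop p_d | p_d].
  have : p %| 1 by rewrite -(Gauss_dvdpr _ cop) mulr1.
  by rewrite dvdp1 gtn_eqF ?irr_p.1.
have [|gcd_p] := irredp_XsubCP irr_p (dvdp_gcdl p d); first by rewrite gcdp_eqp1.
by case: p_d; rewrite -(eqp_dvdl _ gcd_p) dvdp_gcdr.
Qed.

Lemma coprimep_prod_irr p (s : seq {poly F}) :
  irreducible_poly p -> p \is monic -> p \notin s ->
  (forall g, g \in s -> irreducible_poly g /\ g \is monic) ->
  coprimep p (\prod_(g <- s) g).
Proof.
move=> irr_p mon_p; elim: s => [|g s IHs]; first by rewrite big_nil coprimep1.
rewrite inE negb_or => /andP[neq_pg p_s] irr_s; rewrite big_cons coprimepMr.
rewrite IHs // ?andbT; last by move=> w ws; apply: irr_s; rewrite inE ws orbT.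
have [irr_g mon_g] := irr_s g (mem_head _ _).
rewrite irr_coprimep_ndvdp //; apply: contra neq_pg => p_g.
by rewrite -eqp_monic //; apply: irr_g; rewrite // gtn_eqF ?irr_p.1.
Qed.

Lemma dvdp_prod_irr h (s : seq {poly F}) : uniq s ->
  (forall p, p \in s -> [/\ irreducible_poly p, p \is monic & p %| h]) ->
  \prod_(p <- s) p %| h.
Proof.
elim: s => [|p s IHs] /=; first by rewrite big_nil dvd1p.
case/andP=> p_s uniq_s irr_s; have [irr_p mon_p p_h] := irr_s p (mem_head _ _).
have irr_s' g : g \in s -> [/\ irreducible_poly g, g \is monic & g %| h].
  by move=> gs; apply: irr_s; rewrite inE gs orbT.
rewrite big_cons Gauss_dvdp ?p_h ?IHs // coprimep_prod_irr //.
by move=> g /irr_s'[].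
Qed.

Lemma squarefree_prod_irr (s : seq {poly F}) : uniq s ->
  (forall p, p \in s -> irreducible_poly p /\ p \is monic) ->
  squarefree_poly (\prod_(p <- s) p).
Proof.
elim: s => [|p s IHs] /=.
  rewrite big_nil => _ _ d dd; apply: size1_poly_unit; apply/eqP.
  by rewrite -dvdp1; apply: dvdp_trans dd; rewrite expr2 dvdp_mulr.
case/andP=> p_s uniq_s irr_s d; rewrite big_cons; set D := \prod_(g <- s) g in IHs *.
have [irr_p mon_p] := irr_s p (mem_head _ _).
have irr_s' g : g \in s -> irreducible_poly g /\ g \is monic.
  by move=> gs; apply: irr_s; rewrite inE gs orbT.
have cop : coprimep p D by apply: coprimep_prod_irr.
move=> dd; have cop_pd : coprimep p d.
  rewrite irr_coprimep_ndvdp //; apply/negP => p_d; move: cop.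
  rewrite irr_coprimep_ndvdp // => /negP[].
  rewrite -(@dvdp_mul2l _ p) ?irredp_neq0 //.
  by apply: dvdp_trans dd; rewrite expr2 dvdp_mul.
apply: (IHs uniq_s irr_s'); rewrite -(@Gauss_dvdpr _ _ p) //.
by rewrite coprimep_sym coprimep_expr.
Qed.

Lemma size_prod_monic (s : seq {poly F}) :
  (forall p, p \in s -> p \is monic) ->
  (size (\prod_(p <- s) p)).-1 = (\sum_(p <- s) (size p).-1)%N.
Proof.
elim: s => [|p s IHs] mon_s; first by rewrite !big_nil size_poly1.
have mon_p := mon_s p (mem_head _ _).
have mon_s' g : g \in s -> g \is monic by move=> gs; rewrite mon_s // inE gs orbT.
have nz_s : \prod_(g <- s) g != 0.
  by rewrite monic_neq0 // big_seq rpred_prod // => g /mon_s'.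
rewrite !big_cons -IHs // size_monicM //.
have := monic_neq0 mon_p; move: nz_s; rewrite -!size_poly_gt0.
by case: (size p) (size (\prod_(g <- s) g)) => [|a] [|b] // _ _; rewrite addSn addnS.
Qed.

Lemma monic_irreducible_factor (p : {poly F}) : (1 < size p)%N ->
  exists d, [/\ irreducible_poly d, d \is monic & d %| p].
Proof.
have [m] := ubnP (size p); elim: m p => // m IHm p le_pm p_gt1.
have [irr_p|] := pselect (irreducible_poly p).
  have nz_p := irredp_neq0 irr_p.
  have e : (lead_coef p)^-1 *: p %= p.
    by rewrite eqp_scale // invr_eq0 lead_coef_eq0.
  exists ((lead_coef p)^-1 *: p); split; last by rewrite (eqp_dvdl _ e).
    split=> [|d d1 d_p]; first by rewrite (eqp_size e).
    by rewrite (eqp_rtrans e) irr_p // -(eqp_dvdr _ e).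
  by rewrite monicE lead_coefZ mulVf // lead_coef_eq0.
move/not_andP => [//|/existsNP[d]] /not_implyP[d1] /not_implyP[d_p neq_dp].
have nz_p : p != 0 by rewrite -size_poly_gt0 ltnW.
have lt_dp : (size d < size p)%N.
  by rewrite ltn_neqAle dvdp_leq // andbT dvdp_size_eqp //; apply/negP.
have [||w [irr_w mon_w w_d]] := IHm d.
- by apply: leq_trans lt_dp _; rewrite -ltnS.
- by rewrite ltn_neqAle eq_sym d1 size_poly_gt0 (dvdpN0 d_p).
by exists w; split=> //; apply: dvdp_trans d_p.
Qed.

End IrreducibleFactors.

(** The finite type of the monic irreducible factors of [h != 0], which have
    size at most [size h]. *)
Definition irr_factor (F : finFieldType) (h : {poly F}) :=
  {d : {poly_(size h) F} | [&& (d : {poly F}) \is monic, (d : {poly F}) %| h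
        & `[< irreducible_poly (d : {poly F}) >]]}.

(** Products of distinct monic irreducible factors are squarefree, and a set of
    such factors can be recovered from its product. *)
Lemma W_poly_ge (F : finFieldType) (h : {poly F}) : h != 0 ->
  (2 ^ #|{: irr_factor h}| <= W_poly h)%N.
Proof.
move=> nz_h; pose I := (irr_factor h : finType).
pose P (i : I) : {poly F} := val (val i).
have irrP i : [/\ irreducible_poly (P i), P i \is monic & P i %| h].
  by have /and3P[mon dvd /asboolP irr] := valP i.
have injP : injective P by move=> i j /val_inj/val_inj.
pose prodI (S : {set I}) := \prod_(p <- map P (enum S)) p.
have uniqS (S : {set I}) : uniq (map P (enum S)) by rewrite map_inj_uniq ?enum_uniq.
have irrS (S : {set I}) p : p \in map P (enum S) -> irreducible_poly p /\ p \is monic.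
  by case/mapP=> i _ ->; case: (irrP i).
have memS (S : {set I}) i : (P i %| prodI S) = (i \in S).
  have [irr_i mon_i _] := irrP i.
  have [iS | iS] := boolP (i \in S).
    by rewrite /prodI big_map big_enum (bigD1 i) //= dvdp_mulr.
  apply: negbTE; rewrite -irr_coprimep_ndvdp //; apply: coprimep_prod_irr => //.
    by rewrite mem_map ?mem_enum.
  exact: irrS.
have inj_prod : injective prodI.
  by move=> S T eqST; apply/setP=> i; rewrite -!memS eqST.
have dvdS S : prodI S %| h.
  by apply: dvdp_prod_irr => // p /mapP[i _ ->]; apply: irrP.
pose g (S : {set I}) : {poly_(size h) F} := insubd 0 (prodI S).
have gE S : g S = prodI S :> {poly F} by rewrite val_insubd qualifE /= dvdp_leq.
have inj_g : injective g by move=> S T eqST; apply: inj_prod; rewrite -!gE eqST.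
have -> : (2 ^ #|{: irr_factor h}|)%N = #|g @: [set: {set I}]|.
  by rewrite card_imset // -powersetT card_powerset cardsT.
apply/subset_leq_card/subsetP=> _ /imsetP[S _ ->]; rewrite inE gE dvdS /=.
apply/andP; split; first by rewrite /prodI big_seq rpred_prod // => p /irrS[].
by apply/asboolP/squarefree_prod_irr => //; apply: irrS.
Qed.

(** * Linearized polynomials *)

Section Linearized.

Variables (F : finFieldType) (L : fieldExtType F).
Local Notation q := #|F|.
Local Notation n := (\dim {:L}).
Implicit Types (g h w : {poly F}) (a x : L).

(** The Frobenius map of [L] over [F]. *)
Definition frob (x : L) : L := x ^+ q.

Lemma frobD : {morph frob : x y / x + y}.
Proof.
move=> x y; apply: exprDn_pchar; have [p pr_p pcharFp] := finPcharP F.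
have pq : p.-nat q.
  have := abelem_pgroup (fin_ring_pchar_abelem pcharFp).
  by rewrite /pgroup cardsT.
by apply: sub_in_pnat pq => l _ /eqP ->; rewrite pchar_lalg.
Qed.

Lemma frob_is_linear : linear frob.
Proof.
by move=> c x y; rewrite frobD /frob exprZn expf_card.
Qed.

HB.instance Definition _ := GRing.isLinear.Build F L L *:%R frob frob_is_linear.

(** The linearized polynomial attached to [g], acting on [L]; it makes [L] an
    [F[X]]-module on which ['X] acts as the Frobenius map. *)
Definition linpoly g (x : L) : L := \sum_(i < size g) g`_i *: x ^+ (q ^ i).

Lemma linpoly_widen m g x : (size g <= m)%N ->
  linpoly g x = \sum_(i < m) g`_i *: x ^+ (q ^ i).
Proof.
move=> le_gm; rewrite /linpoly -(big_mkord xpredT (fun i => g`_i *: x ^+ (q ^ i))).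
rewrite -[RHS](big_mkord xpredT (fun i => g`_i *: x ^+ (q ^ i))).
rewrite [RHS](big_cat_nat (leq0n _) le_gm) /= -[LHS]addr0; congr (_ + _).
rewrite big_nat_cond big1 // => i.
by case/andP=> /andP[le_gi _] _; rewrite nth_default // scale0r.
Qed.

Lemma linpolyD g h x : linpoly (g + h) x = linpoly g x + linpoly h x.
Proof.
pose m := maxn (size g) (size h).
rewrite !(@linpoly_widen m) ?leq_maxl ?leq_maxr ?size_polyD //.
by rewrite -big_split; apply: eq_bigr => i _; rewrite coefD scalerDl.
Qed.

Lemma linpolyZ c g x : linpoly (c *: g) x = c *: linpoly g x.
Proof.
rewrite !(@linpoly_widen (size g)) ?size_scale_leq // scaler_sumr.
by apply: eq_bigr => i _; rewrite coefZ scalerA.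
Qed.

Lemma linpolyC c x : linpoly c%:P x = c *: x.
Proof.
rewrite (@linpoly_widen 1) ?size_polyC ?leq_b1 // big_ord1 coefC /= expn0.
by rewrite expr1.
Qed.

Lemma linpolyMX g x : linpoly (g * 'X) x = linpoly g (x ^+ q).
Proof.
rewrite (@linpoly_widen (size g).+1); last first.
  by rewrite (leq_trans (size_polyMleq _ _)) // size_polyX addn2.
rewrite big_ord_recl coefMX /= scale0r add0r; apply: eq_bigr => i _.
by rewrite coefMX /= -exprM -expnS.
Qed.

Fact linpoly_is_linear g : linear (linpoly g).
Proof.
elim/poly_ind: g => [|g c IHg] k x y.
  by rewrite /linpoly size_poly0 !big_ord0 scaler0 addr0.
rewrite !linpolyD !linpolyC !linpolyMX -!/(frob _) linearP IHg.
by rewrite !scalerDr !scalerA addrACA [c * k]mulrC.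
Qed.

HB.instance Definition _ g :=
  GRing.isLinear.Build F L L *:%R (linpoly g) (linpoly_is_linear g).

Lemma linpolyM g h x : linpoly (g * h) x = linpoly g (linpoly h x).
Proof.
elim/poly_ind: h x => [|h c IHh] x.
  by rewrite mulr0 /linpoly size_poly0 !big_ord0 -/(linpoly g 0) linear0.
rewrite mulrDr mulrA linpolyD linpolyMX IHh linpolyD linpolyC linpolyMX raddfD /=.
by rewrite mulrC mul_polyC linpolyZ linearZ.
Qed.

Lemma linpolyXn i x : linpoly 'X^i x = x ^+ (q ^ i).
Proof.
elim: i x => [|i IHi] x; first by rewrite linpolyC scale1r.
by rewrite exprSr linpolyMX IHi -exprM -expnS.
Qed.

Lemma expr_card_dim x : x ^+ (q ^ n) = x.
Proof. by have := memvf x; rewrite (Fermat's_little_theorem {:L}%AS) => /eqP. Qed.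

Lemma linpolyXn_sub1 x : linpoly ('X^n - 1) x = 0.
Proof.
rewrite -scaleN1r linpolyD linpolyZ linpolyXn linpolyC expr_card_dim.
by rewrite scale1r scaleN1r subrr.
Qed.

(** The elements of [L] annihilated by [g]. *)
Definition linpoly_ker g : {vspace L} := lker (linfun (linpoly g)).

Lemma mem_linpoly_ker g x : (x \in linpoly_ker g) = (linpoly g x == 0).
Proof. by rewrite memv_ker lfunE. Qed.

(** The elements of the kernel are roots of a polynomial of degree [q^d], where
    [d] is the degree of [g]. *)
Lemma dim_linpoly_ker_le g : g \is monic -> (\dim (linpoly_ker g) <= (size g).-1)%N.
Proof.
move=> mon_g; set d := (size g).-1.
have sg : size g = d.+1 by rewrite prednK // size_poly_gt0 monic_neq0.
pose P : {poly L} := \sum_(i < d.+1) (g`_i)%:A *: 'X^(q ^ i).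
have q_gt1 : (1 < q)%N := finNzRing_gt1 F.
have sP : size P = (q ^ d).+1.
  rewrite /P big_ord_recr /= (_ : g`_d = 1); last first.
    by move/monicP: mon_g; rewrite /lead_coef -/d.
  rewrite !scale1r addrC size_polyDl ?size_polyXn // ltnS.
  apply: (leq_trans (size_sum _ _ _)); apply/bigmax_leqP => i _.
  by rewrite (leq_trans (size_scale_leq _ _)) // size_polyXn ltn_exp2l.
have P_neq0 : P != 0 by rewrite -size_poly_gt0 sP.
have rootP x : x \in linpoly_ker g -> root P x.
  rewrite mem_linpoly_ker rootE => /eqP <-; rewrite /linpoly sg horner_sum.
  by apply/eqP/eq_bigr => i _; rewrite hornerZ hornerXn mulr_algl.
pose E := finvect_type L.
pose s := enum (mem (linpoly_ker g) : {pred E}).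
have := @max_poly_roots L P s P_neq0.
rewrite sP ltnS -[size _]cardE card_vspace leq_exp2l //; apply.
  by apply/allP => x; rewrite (@mem_enum E); apply: rootP.
exact: enum_uniq.
Qed.

(** Writing ['X^n - 1 = h * g], the image of [h] lies in the kernel of [g]; the
    upper bounds on the dimensions of both kernels then force equality. *)
Lemma dim_linpoly_ker g :
  g \is monic -> g %| 'X^n - 1 -> \dim (linpoly_ker g) = (size g).-1.
Proof.
move=> mon_g /dvdpP[h Eh].
have n_gt0 : (0 < n)%N := adim_gt0 _.
have mon_Xn : 'X^n - 1 \is @monic F by exact: monicXnsubC.
have mon_h : h \is monic by rewrite Eh (monicMr _ mon_g) in mon_Xn.
have sE : n.+1 = ((size g).-1 + (size h).-1).+1.
  rewrite -(size_XnsubC (1 : F) n_gt0) Eh size_mul ?monic_neq0 //.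
  move: (monic_neq0 mon_g) (monic_neq0 mon_h); rewrite -!size_poly_gt0.
  by case: (size g) (size h) => [|a] [|b] // _ _; rewrite addSn addnS /= addnC.
apply/eqP; rewrite eqn_leq dim_linpoly_ker_le //=.
have le_img : (limg (linfun (linpoly h)) <= linpoly_ker g)%VS.
  apply/subvP=> _ /memv_imgP[x _ ->]; rewrite mem_linpoly_ker lfunE -linpolyM.
  by rewrite mulrC -Eh linpolyXn_sub1.
apply: leq_trans (dimvS le_img).
have := limg_ker_dim (linfun (linpoly h)) fullv.
rewrite capfv -/(linpoly_ker h).
have := dim_linpoly_ker_le mon_h.
move: sE; move: (size g).-1 (size h).-1 (\dim (linpoly_ker h)) (\dim (limg _)) n.
by move=> a b c d m; lia.
Qed.

Lemma linpoly_ker_dvd g h : g %| h -> (linpoly_ker g <= linpoly_ker h)%VS.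
Proof.
case/dvdpP=> w ->; apply/subvP=> x; rewrite !mem_linpoly_ker linpolyM => /eqP->.
by rewrite linear0.
Qed.

Lemma mem_linpoly_ker_gcd g h x :
  x \in linpoly_ker g -> x \in linpoly_ker h -> x \in linpoly_ker (gcdp g h).
Proof.
rewrite !mem_linpoly_ker => /eqP gx /eqP hx.
have [[u v] /= uv] := Bezoutp g h.
suff uv0 : x \in linpoly_ker (u * g + v * h).
  have uvd : u * g + v * h %| gcdp g h by rewrite (eqp_dvdl _ uv).
  by rewrite -mem_linpoly_ker (subvP (linpoly_ker_dvd uvd)).
by rewrite mem_linpoly_ker linpolyD !linpolyM gx hx !linear0 addr0.
Qed.

(** If [x] is annihilated by [h] and by [h / p] for each of the distinct primes
    [p] in [s], then it is annihilated by [h / prod s]. *)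
Lemma linpoly_ker_cap h (s : seq {poly F}) x : h != 0 -> uniq s ->
  (forall p, p \in s -> [/\ irreducible_poly p, p \is monic & p %| h]) ->
  x \in linpoly_ker h -> (forall p, p \in s -> x \in linpoly_ker (h %/ p)) ->
  x \in linpoly_ker (h %/ \prod_(p <- s) p).
Proof.
move=> nz_h uniq_s irr_s hx; elim: s uniq_s irr_s => [|p s IHs] uniq_ps irr_s xs.
  by rewrite big_nil divp1.
have pD_h := dvdp_prod_irr uniq_ps irr_s.
rewrite big_cons in pD_h *; set D := \prod_(g <- s) g in IHs pD_h *.
have {uniq_ps} /andP[p_s uniq_s] := uniq_ps.
have irr_s' g : g \in s -> [/\ irreducible_poly g, g \is monic & g %| h].
  by move=> gs; apply: irr_s; rewrite inE gs orbT.
have xD : x \in linpoly_ker (h %/ D).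
  by apply: IHs => // g gs; apply: xs; rewrite inE gs orbT.
have xp := xs p (mem_head _ _).
have [irr_p mon_p _] := irr_s p (mem_head _ _).
have cop : coprimep p D by apply: coprimep_prod_irr => // g /irr_s'[].
(* With [h = w * (p * D)], the gcd of [h / p = w * D] and [h / D = w * p] is [w],
   because [p] and [D] are coprime. *)
have /dvdpP[w Ew] := pD_h.
have nz_pD : p * D != 0 by apply: contraNneq nz_h => pD0; rewrite Ew pD0 mulr0.
move: (nz_pD); rewrite mulf_eq0 negb_or => /andP[nz_p nz_D].
have Ep : h %/ p = w * D by rewrite Ew [p * D]mulrC mulrA mulpK.
have ED : h %/ D = w * p by rewrite Ew mulrA mulpK.
have EpD : h %/ (p * D) = w by rewrite Ew mulpK.
have gcd_w : gcdp (w * D) (w * p) %| w.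
  rewrite (eqp_dvdl _ (gcdp_mul2l _ _ _)) -{2}[w]mulr1 dvdp_mul2l.
    by rewrite dvdp1 -/(coprimep D p) coprimep_sym.
  by apply: contraNneq nz_h => w0; rewrite Ew w0 mul0r.
by rewrite EpD (subvP (linpoly_ker_dvd gcd_w)) // mem_linpoly_ker_gcd -?Ep -?ED.
Qed.

(** ** The polynomial [g_poly] and normality *)

Local Notation G := (@g_poly F L).

Lemma g_polyE a : G a = \sum_(i < n) a ^+ (q ^ i) *: 'X^(n - 1 - i).
Proof. by rewrite /g_poly big_mkord. Qed.

Lemma g_polyD a b : G (a + b) = G a + G b.
Proof.
rewrite !g_polyE -big_split; apply: eq_bigr => i _.
by rewrite -!linpolyXn linearD scalerDl.
Qed.

Lemma g_polyZ (c : F) a : G (c *: a) = c%:A *: G a.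
Proof.
rewrite !g_polyE scaler_sumr; apply: eq_bigr => i _.
by rewrite -!linpolyXn linearZ scalerA mulr_algl.
Qed.

Lemma coef_g_poly a i : (i < n)%N -> (G a)`_(n - 1 - i) = a ^+ (q ^ i).
Proof.
move=> lt_in; rewrite g_polyE coef_sum (bigD1 (Ordinal lt_in)) //= big1 ?addr0.
  by rewrite coefZ coefXn eqxx mulr1.
move=> j /eqP neq_ji; rewrite coefZ coefXn; case: eqP => [E|]; last by rewrite mulr0.
case: neq_ji; apply/val_inj => /=; move: E (ltn_ord j); move: (val j) => m.
by move: n lt_in => d; lia.
Qed.

Lemma size_g_poly a : (size (G a) <= n)%N.
Proof.
rewrite g_polyE; apply: (leq_trans (size_sum _ _ _)); apply/bigmax_leqP => i _.
rewrite (leq_trans (size_scale_leq _ _)) // size_polyXn.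
by case: i => j /=; move: n => m; lia.
Qed.

Lemma mulX_g_poly a : 'X * G a = G (a ^+ q) + a *: ('X^n - 1).
Proof.
have [m Em] : exists m, n = m.+1 by exists n.-1; rewrite prednK // adim_gt0.
have aqn : a ^+ (q ^ m.+1) = a by rewrite -Em expr_card_dim.
rewrite !g_polyE Em subn1 /= mulr_sumr.
rewrite big_ord_recl [in RHS]big_ord_recr /= subn0 subnn expr1.
rewrite -exprM -expnS aqn -scalerAr -exprS scalerBr.
rewrite expr0 [RHS]addrACA subrr addr0 addrC; congr (_ + _).
apply: eq_bigr => i _; rewrite -scalerAr -exprS -exprM -expnS.
by rewrite /bump /= add1n -subSn.
Qed.

Lemma dvdp_XnsubC_g_poly a : ('X^n - 1 %| G a) = (a == 0).
Proof.
have n_gt0 : (0 < n)%N := adim_gt0 _.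
apply/idP/eqP => [dvd_G | ->]; last first.
  rewrite g_polyE big1 ?dvdp0 // => i _.
  by rewrite -linpolyXn linear0 scale0r.
have /eqP : G a == 0.
  apply: contraTT dvd_G => nz_G; apply/negP => /(dvdp_leq nz_G).
  by rewrite size_XnsubC // ltnNge size_g_poly.
by move/polyP/(_ (n - 1 - 0)%N); rewrite coef_g_poly // coef0 expr1.
Qed.

Lemma map_alg_Xn m : map_poly (in_alg L) ('X^m - 1) = 'X^m - 1.
Proof. by rewrite rmorphB /= rmorph1 map_polyXn. Qed.

(** Modulo ['X^n - 1], multiplying [g_poly a] by [w] amounts to applying [w] to
    [a]. *)
Lemma dvdp_g_poly_linpoly w a :
  'X^n - 1 %| map_poly (in_alg L) w * G a - G (linpoly w a).
Proof.
elim/poly_ind: w a => [|w c IHw] a.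
  rewrite rmorph0 mul0r sub0r /linpoly size_poly0 big_ord0 dvdpNr.
  by rewrite dvdp_XnsubC_g_poly.
rewrite linpolyD linpolyC linpolyMX g_polyD g_polyZ rmorphD rmorphM /=.
rewrite map_polyX map_polyC /= mulrDl -mulrA mulX_g_poly mulrDr mul_polyC.
rewrite opprD addrACA subrr addr0 addrAC.
by rewrite dvdp_add ?IHw // -mul_polyC mulrA dvdp_mulIr.
Qed.

Lemma dvdp_g_poly w w' a : w' * w = 'X^n - 1 ->
  (map_poly (in_alg L) w %| G a) = (a \in linpoly_ker w').
Proof.
move=> ww'; rewrite mem_linpoly_ker -dvdp_XnsubC_g_poly.
have := dvdp_g_poly_linpoly w' a; set W' := map_poly _ w'; set W := map_poly _ w.
have WW : W' * W = 'X^n - 1 by rewrite -rmorphM ww' /= map_alg_Xn.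
have nz_W' : W' != 0.
  apply/negP=> /eqP W0; move: WW; rewrite W0 mul0r => /esym/eqP.
  by rewrite (negPf (monic_neq0 (monicXnsubC _ (adim_gt0 _)))).
move=> dvd_sub; rewrite -(dvdp_addr (G (linpoly w' a)) dvd_sub) subrK -WW.
by rewrite dvdp_mul2l.
Qed.

Lemma frob_is_monoid_morphism : monoid_morphism frob.
Proof. by split=> [|x y]; rewrite /frob ?expr1n ?exprMn. Qed.

HB.instance Definition _ :=
  GRing.isMonoidMorphism.Build L L frob frob_is_monoid_morphism.

Lemma map_frob_g_poly a : map_poly frob (G a) = G (frob a).
Proof.
rewrite !g_polyE rmorph_sum; apply: eq_bigr => i _.
by rewrite /= map_polyZ map_polyXn /= /frob exprAC.
Qed.

Lemma frob_fixed_poly (d : {poly L}) :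
  map_poly frob d = d -> exists w : {poly F}, d = map_poly (in_alg L) w.
Proof.
move=> fix_d; apply/polyOver1P/polyOverP => i.
rewrite (Fermat's_little_theorem 1%AS) dimv1 expn1.
by rewrite -{2}fix_d coef_map.
Qed.

(** The Frobenius map sends [g_poly a] to [g_poly (frob a)], which is congruent
    to ['X * g_poly a]; hence it fixes the monic associate of the gcd, which
    therefore has coefficients in [F]. *)
Lemma gcdp_g_poly_base a :
  exists w : {poly F}, gcdp ('X^n - 1) (G a) %= map_poly (in_alg L) w.
Proof.
set d := gcdp _ _.
have nz_d : d != 0.
  by rewrite gcdp_eq0 negb_and (monic_neq0 (monicXnsubC _ (adim_gt0 _))).
pose d1 := (lead_coef d)^-1 *: d.
have d1d : d1 %= d by rewrite eqp_scale // invr_eq0 lead_coef_eq0.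
have mon_d1 : d1 \is monic.
  by rewrite monicE lead_coefZ mulVf // lead_coef_eq0.
have [w Ew] : exists w : {poly F}, d1 = map_poly (in_alg L) w.
  apply: frob_fixed_poly; apply/eqP; rewrite -eqp_monic // ?map_monic //.
  have map_d : map_poly frob d %= d.
    rewrite gcdp_map map_frob_g_poly rmorphB /= rmorph1 map_polyXn.
    have step : gcdp ('X^n - 1) (G (frob a)) %= gcdp ('X^n - 1) ('X * G a).
      rewrite mulX_g_poly [G _ + _]addrC -mul_polyC eqp_sym; exact: gcdp_addl_mul.
    rewrite (eqp_ltrans step); apply: Gauss_gcdpr.
    rewrite -[X in coprimep _ X]subr0 -polyC0 coprimep_XsubC rootE.
    rewrite hornerD hornerN hornerC hornerXn expr0n.
    by rewrite gtn_eqF ?adim_gt0 // sub0r oppr_eq0 oner_eq0.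
  have map_d1 : map_poly frob d1 %= map_poly frob d by rewrite eqp_map.
  by rewrite (eqp_rtrans d1d) (eqp_trans map_d1).
by exists w; rewrite -Ew eqp_sym.
Qed.

(** By [gcdp_g_poly_base] the gcd in the definition of normality is associated to
    some [w] over [F].  As [h] annihilates [a], [f] divides [w]; if the quotient
    had an irreducible factor [p], then [h / p] would annihilate [a]. *)
Lemma k_normal_linpoly_ker (f h : {poly F}) a : f * h = 'X^n - 1 -> f \is monic ->
  a \in linpoly_ker h ->
  (forall p, irreducible_poly p -> p \is monic -> p %| h ->
     a \notin linpoly_ker (h %/ p)) ->
  h != 1 -> k_normal (size f).-1 a.
Proof.
move=> fh mon_f ha hpa h_neq1; have n_gt0 : (0 < n)%N := adim_gt0 _.
have nz_Xn : 'X^n - 1 != 0 :> {poly F} by rewrite monic_neq0 ?monicXnsubC.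
have mon_h : h \is monic by rewrite -(monicMl _ mon_f) fh monicXnsubC.
have nz_f := monic_neq0 mon_f; have nz_h := monic_neq0 mon_h.
have size_h : (1 < size h)%N.
  rewrite ltn_neqAle size_poly_gt0 nz_h andbT eq_sym.
  apply: contraNneq h_neq1 => h1; rewrite -(eqp_monic mon_h) ?monic1 //.
  by rewrite -size_poly_eq1 h1.
have [w Ew] := gcdp_g_poly_base a.
have w_Xn : w %| 'X^n - 1.
  by rewrite -(dvdp_map (in_alg L)) -(eqp_dvdl _ Ew) /= map_alg_Xn dvdp_gcdl.
have f_w : f %| w.
  rewrite -(dvdp_map (in_alg L)) -(eqp_dvdr _ Ew) dvdp_gcd -{1}map_alg_Xn dvdp_map.
  by rewrite -fh dvdp_mulr //= (@dvdp_g_poly _ h) // mulrC.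
have w_f : w %| f.
  case/dvdpP: f_w => v Ev; have nz_v : v != 0.
    by apply: contraNneq nz_Xn => v0; rewrite -dvd0p -(mul0r f) -v0 -Ev.
  have [v1|v1] := eqVneq (size v) 1%N.
    by rewrite Ev -[X in _ %| X]mul1r dvdp_mul // dvdp1 v1.
  have [|p [irr_p mon_p p_v]] := @monic_irreducible_factor _ v.
    by rewrite ltn_neqAle eq_sym v1 size_poly_gt0.
  have v_h : v %| h by rewrite -(dvdp_mul2r _ _ nz_f) -Ev [h * f]mulrC fh.
  have p_h := dvdp_trans p_v v_h.
  have := hpa p irr_p mon_p p_h; rewrite -(@dvdp_g_poly (f * p)); last first.
    by rewrite [f * p]mulrC mulrA divpK // mulrC.
  case/negP; apply: (@dvdp_trans _ (map_poly (in_alg L) w)).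
    by rewrite dvdp_map Ev mulrC dvdp_mul.
  by rewrite -(eqp_dvdl _ Ew) dvdp_gcdr.
have sizeE : n.+1 = ((size f).-1 + size h)%N.
  rewrite -(size_XnsubC (1 : F) n_gt0) -fh size_mul //.
  by move: nz_f; rewrite -size_poly_gt0; case: (size f).
have sf : (size f).-1.+1 = size f by rewrite prednK // size_poly_gt0.
rewrite /k_normal; apply/andP; split.
  by move: size_h sizeE; move: (size h) (size f).-1 n => b c m; lia.
rewrite (eqp_size Ew) size_map_poly sf; apply/eqP/eqp_size.
by rewrite /eqp w_f f_w.
Qed.

End Linearized.

(** * Elements with given annihilator *)

Section AddSieve.

Variables (F : finFieldType) (L : fieldExtType F).
(** The field [L] itself, with its structure of finite field. *)
Let E : finFieldType := finvect_type L.
Local Notation A := [set: E]%G.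
Local Notation q := #|F|.
Local Notation n := (\dim {:L}).

(** The additive group of a subspace of [L]. *)
Definition vspace_set (W : {vspace L}) : {set E} := [set x : E | (x : L) \in W].

Lemma vspace_group_set W : group_set (vspace_set W).
Proof.
apply/group_setP; split=> [|x y]; rewrite !inE; first exact: mem0v.
exact: memvD.
Qed.

Canonical vspace_group W := group (vspace_group_set W).

Lemma card_vspace_set W : #|vspace_set W| = (q ^ \dim W)%N.
Proof. by rewrite cardsE -(card_vspace (T := E) W); apply: eq_card. Qed.

(** The sieve with [V0] the kernel of [h] and [V p] the kernel of [h / p], for
    [p] a monic irreducible factor of [h]. *)
Lemma add_sieve (f h : {poly F}) : f * h = 'X^n - 1 -> f \is monic ->
  exists psi : 'CF(A), [/\ forall x, psi x != 0 ->
      (x : L) \in linpoly_ker L h /\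
      forall p, irreducible_poly p -> p \is monic -> p %| h ->
        (x : L) \notin linpoly_ker L (h %/ p),
    '[psi, 'chi_0] = 1 &
    \sum_(j | j != 0) `|'[psi, 'chi_j]| <=
      (q ^ (size f).-1 * 2 ^ #|{: irr_factor h}|)%:R - 1].
Proof.
move=> fh mon_f.
have n_gt0 : (0 < n)%N := adim_gt0 _.
have nz_Xn : 'X^n - 1 != 0 :> {poly F} by rewrite monic_neq0 ?monicXnsubC.
have mon_h : h \is monic by rewrite -(monicMl _ mon_f) fh monicXnsubC.
have nz_f := monic_neq0 mon_f; have nz_h := monic_neq0 mon_h.
have h_Xn : h %| 'X^n - 1 by rewrite -fh dvdp_mull.
pose V0 := vspace_group (linpoly_ker L h).
pose I := (irr_factor h : finType).
pose P (i : I) : {poly F} := val (val i).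
pose V (i : I) := vspace_group (linpoly_ker L (h %/ P i)).
have irrP i : [/\ irreducible_poly (P i), P i \is monic & P i %| h].
  by have /and3P[mon dvd /asboolP irr] := valP i.
have injP : injective P by move=> i j /val_inj/val_inj.
have sV0 : V0 \subset A by apply: subsetT.
have sV i : V i \subset V0.
  have [_ _ ih] := irrP i.
  apply/subsetP=> x; rewrite !inE; apply: (subvP (linpoly_ker_dvd _ _)).
  by rewrite -{2}(divpK ih) dvdp_mulr.
have mon_div d : d \is monic -> d %| h -> h %/ d \is monic.
  by move=> mon_d d_h; rewrite -(monicMr _ mon_d) divpK.
have card_div d : d \is monic -> d %| h ->
    (#|vspace_set (linpoly_ker L (h %/ d))| * q ^ (size d).-1)%N = #|V0|.
  move=> mon_d d_h; rewrite !card_vspace_set !dim_linpoly_ker ?mon_div //; last first.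
    by apply: dvdp_trans h_Xn; rewrite -{2}(divpK d_h) dvdp_mulr.
  rewrite -expnD -[in RHS](divpK d_h) size_mul ?monic_neq0 ?mon_div //.
  have := monic_neq0 (mon_div d mon_d d_h); have := monic_neq0 mon_d.
  rewrite -!size_poly_gt0.
  by case: (size d) (size (h %/ d)) => [|a] [|b] // _ _; rewrite addSn addnS /=.
have V_gt0 W : (0 < #|vspace_set W|)%N.
  by rewrite card_vspace_set expn_gt0 ltnW ?finNzRing_gt1.
have indexV i : #|V0 : V i| = (q ^ (size (P i)).-1)%N.
  have [_ mon_i ih] := irrP i.
  by rewrite -divgS // -(card_div _ mon_i ih) mulKn.
have index_gt1 i : (1 < #|V0 : V i|)%N.
  have [[s1 _] _ _] := irrP i; rewrite indexV.
  by rewrite -{1}(expn0 q) ltn_exp2l ?finNzRing_gt1 // -subn1 subn_gt0.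
have index_cap (S : {set I}) :
  (#|V0 :&: \bigcap_(i in S) V i| * \prod_(i in S) #|V0 : V i|)%N = #|V0|.
  rewrite [X in (_ * X)%N](eq_bigr _ (fun i _ => indexV i)).
  pose s := map P (enum S); pose D := \prod_(p <- s) p.
  have uniq_s : uniq s by rewrite map_inj_uniq ?enum_uniq.
  have s_irr p : p \in s -> [/\ irreducible_poly p, p \is monic & p %| h].
    by case/mapP=> i _ ->.
  have s_D p : p \in s -> p %| D.
    by move=> ps; rewrite /D (big_rem p) //= dvdp_mulr.
  have mon_D : D \is monic by rewrite /D big_seq rpred_prod // => p /s_irr[].
  have D_h : D %| h by apply: dvdp_prod_irr.
  have size_D : (\prod_(i in S) q ^ (size (P i)).-1)%N = (q ^ (size D).-1)%N.
    rewrite -expn_sum; congr (_ ^ _)%N.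
    rewrite -big_enum -(big_map P xpredT (fun p => (size p).-1)).
    by rewrite size_prod_monic // => p /s_irr[].
  suff -> : V0 :&: \bigcap_(i in S) V i =
            vspace_set (linpoly_ker L (h %/ D)) :> {set _}.
    by rewrite size_D card_div.
  apply/setP=> x; rewrite inE; apply/andP/idP => [[V0x /bigcapP Vx] | xD].
    rewrite inE; apply: linpoly_ker_cap => //; first by move: V0x; rewrite inE.
    by move=> p /mapP[i iS ->]; have := Vx i; rewrite -mem_enum iS inE; apply.
  move: xD; rewrite inE => xD; split.
    rewrite inE; apply: (subvP (linpoly_ker_dvd _ _)) xD.
    by rewrite -{2}(divpK D_h) dvdp_mulr.
  apply/bigcapP=> i iS; rewrite inE; apply: (subvP (linpoly_ker_dvd _ _)) xD.
  have /dvdpP[w Ew] : P i %| D by apply: s_D; apply: map_f; rewrite mem_enum.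
  have /dvdpP[v Ev] := D_h; have [_ mon_i _] := irrP i.
  rewrite {2}Ev Ew mulrA !mulpK ?monic_neq0 // -?Ew // Ev mulpK ?monic_neq0 //.
  by rewrite dvdp_mulr.
have ab := add_abelian E.
exists (sieve_cfun A V0 V); split.
- move=> x /(sieve_cfun_supp ab sV0 sV index_gt1)[]; rewrite inE => xh xV.
  split=> // p irr_p mon_p p_h.
  have sp : (size p <= size h)%N by apply: dvdp_leq.
  pose d : {poly_(size h) F} := NPoly (sp : p \is a poly_of_size (size h)).
  have dP : [&& (d : {poly F}) \is monic, (d : {poly F}) %| h
               & `[< irreducible_poly (d : {poly F}) >]].
    by rewrite mon_p p_h; apply/asboolP.
  by have := xV (exist _ d dP); rewrite inE.
- exact: cfdot_sieve_cfun1.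
have := sieve_cfun_norm ab sV0 sV index_gt1 index_cap.
suff -> : #|A : V0| = (q ^ (size f).-1)%N by [].
have cardA : #|A| = (q ^ n)%N.
  by rewrite -(card_vspace_set fullv); apply: eq_card => x; rewrite !inE memvf.
rewrite -divgS // cardA card_vspace_set dim_linpoly_ker //.
have -> : n = ((size f).-1 + (size h).-1)%N.
  apply/eqP; rewrite -eqSS -(size_XnsubC (1 : F) n_gt0) -fh size_monicM //.
  have: (0 < size f)%N by rewrite size_poly_gt0 monic_neq0.
  have: (0 < size h)%N by rewrite size_poly_gt0.
  by case: (size f) (size h) => [|s] [|t] // _ _; rewrite addSn addnS.
by rewrite expnD mulnK // expn_gt0 ltnW ?finNzRing_gt1.
Qed.

End AddSieve.

(** * Products of distinct prime numbers *)

Lemma coprime_prod_primes l (s : seq nat) : prime l -> l \notin s ->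
  (forall g, g \in s -> prime g) -> coprime l (\prod_(g <- s) g).
Proof.
move=> pr_l; elim: s => [|g s IHs]; first by rewrite big_nil coprimen1.
rewrite inE negb_or => /andP[neq_lg l_s] prs; rewrite big_cons coprimeMr IHs //.
  by rewrite andbT prime_coprime // dvdn_prime2 // prs ?mem_head.
by move=> w ws; apply: prs; rewrite inE ws orbT.
Qed.

Lemma squarefree_prod_primes (s : seq nat) : uniq s ->
  (forall l, l \in s -> prime l) -> squarefree_nat (\prod_(l <- s) l)%N.
Proof.
elim: s => [|l s IHs] /=.
  by rewrite big_nil => _ _ d; rewrite dvdn1 -mulnn muln_eq1 => /andP[/eqP].
case/andP=> l_s uniq_s prs d; rewrite big_cons; set D := (\prod_(g <- s) g)%N in IHs *.
have pr_l : prime l by rewrite prs ?mem_head.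
have prs' g : g \in s -> prime g by move=> gs; rewrite prs // inE gs orbT.
have cop : coprime l D by apply: coprime_prod_primes.
move=> dd; have cop_ld : coprime l d.
  rewrite prime_coprime //; apply/negP => l_d; move: cop; rewrite prime_coprime //.
  case/negP; rewrite -(@dvdn_pmul2l l) ?prime_gt0 //.
  by apply: dvdn_trans dd; rewrite -mulnn dvdn_mul.
by apply: (IHs uniq_s prs'); rewrite -(@Gauss_dvdr _ l) // coprime_pexpl // coprime_sym.
Qed.

Lemma dvdn_div2l d D M : (0 < M -> d %| D -> D %| M -> M %/ D %| M %/ d)%N.
Proof.
move=> M_gt0 /dvdnP[e De] /dvdnP[w Mw]; move: M_gt0.
rewrite Mw De !muln_gt0 => /and3P[_ e_gt0 d_gt0].
by rewrite mulnK ?muln_gt0 ?e_gt0 // mulnA mulnK // dvdn_mulr.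
Qed.

(** A divisor [o] of [M] dividing all the [M / l], for distinct prime factors [l]
    of [M], also divides the quotient of [M] by their product. *)
Lemma dvdn_cap M o (s : seq nat) : uniq s -> (0 < M)%N -> (o %| M)%N ->
  (forall l, l \in s -> [/\ prime l, l %| M & o %| M %/ l]%N) ->
  (\prod_(l <- s) l %| M)%N /\ (o %| M %/ \prod_(l <- s) l)%N.
Proof.
move=> uniq_s M_gt0 o_M; elim: s uniq_s => [|l s IHs] /=.
  by rewrite big_nil dvd1n divn1.
case/andP=> l_s uniq_s prs; rewrite big_cons; set D := (\prod_(g <- s) g)%N in IHs *.
have [|D_M oD] := IHs uniq_s.
  by move=> g gs; apply: prs; rewrite inE gs orbT.
have [pr_l l_M ol] := prs l (mem_head _ _).
have cop : coprime l D.
  apply: coprime_prod_primes => // g gs.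
  by have [] := prs g; rewrite // inE gs orbT.
have lD_M : (l * D %| M)%N by rewrite Gauss_dvd // l_M D_M.
(* With [M = w * (l * D)], the gcd of [M / l = w * D] and [M / D = w * l] is [w]. *)
split=> //; have /dvdnP[w Ew] := lD_M.
move: M_gt0; rewrite Ew !muln_gt0 => /andP[w_gt0 /andP[l_gt0 D_gt0]].
have El : (M %/ l = w * D)%N by rewrite Ew mulnA mulnAC mulnK.
have ED : (M %/ D = w * l)%N by rewrite Ew mulnA mulnK.
rewrite -Ew Ew mulnK ?muln_gt0 ?l_gt0 //.
have : (o %| gcdn (w * D) (w * l))%N by rewrite dvdn_gcd -El -ED ol.
by rewrite -muln_gcdr gcdnC (eqP cop) muln1.
Qed.

(** A product over a set of entries of [s], as a product over a sequence of
    distinct entries. *)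
Lemma prod_seq_sub (s : seq nat) (S : {set seq_sub s}) (P : nat -> Prop) :
  (forall i, i \in S -> P (ssval i)) ->
  exists t : seq nat, [/\ uniq t, forall l, l \in t -> l \in s /\ P l &
    (\prod_(i in S) ssval i = \prod_(l <- t) l)%N].
Proof.
move=> PS; exists (map (@ssval _ s) (enum S)); split.
- by rewrite map_inj_uniq ?enum_uniq //; apply: val_inj.
- by move=> l /mapP[i]; rewrite mem_enum => iS ->; split; [exact: ssvalP | exact: PS].
- by rewrite big_map big_enum.
Qed.

(** Products of distinct prime factors are squarefree, and a set of primes can be
    recovered from its product. *)
Lemma W_nat_ge M N : (0 < N)%N -> (M %| N)%N -> (2 ^ size (primes M) <= W_nat N)%N.
Proof.
move=> N_gt0 M_N; pose I := (seq_sub (primes M) : finType).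
have M_gt0 : (0 < M)%N := dvdn_gt0 N_gt0 M_N.
have prI (i : I) : prime (ssval i) /\ (ssval i %| M)%N.
  by have := ssvalP i; rewrite mem_primes => /and3P[].
pose prodI (S : {set I}) := (\prod_(i in S) ssval i)%N.
have prodE S : prodI S = (\prod_(l <- map (@ssval _ _) (enum S)) l)%N.
  by rewrite big_map big_enum.
have uniqS (S : {set I}) : uniq (map (@ssval _ _) (enum S)).
  by rewrite map_inj_uniq ?enum_uniq //; apply: val_inj.
have memS (S : {set I}) i : (ssval i %| prodI S)%N = (i \in S).
  have [iS | iS] := boolP (i \in S); first by rewrite /prodI (bigD1 i) //= dvdn_mulr.
  apply/negP; rewrite prodE; apply/negP; rewrite -prime_coprime; last by case: (prI i).
  apply: coprime_prod_primes; first by case: (prI i).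
    by rewrite mem_map ?mem_enum //; apply: val_inj.
  by move=> l /mapP[j _ ->]; case: (prI j).
have inj_prod : injective prodI.
  by move=> S T eqST; apply/setP=> i; rewrite -!memS eqST.
have -> : (2 ^ size (primes M))%N = size (map prodI (enum {set I})).
  rewrite size_map -cardE -[RHS]cardsT -powersetT card_powerset cardsT.
  by rewrite card_seq_sub ?primes_uniq.
rewrite /W_nat -size_filter; apply: uniq_leq_size.
  by rewrite map_inj_uniq ?enum_uniq.
move=> _ /mapP[S _ ->]; rewrite mem_filter -dvdn_divisors //; apply/andP; split.
  apply/asboolP; rewrite prodE; apply: squarefree_prod_primes => // l /mapP[j _ ->].
  by case: (prI j).
(* Taking [o = 1] in [dvdn_cap] leaves its first conclusion only. *)
rewrite prodE; apply: dvdn_trans M_N.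
have [|//] := @dvdn_cap M 1 _ (uniqS S) M_gt0 (dvd1n _).
by move=> l /mapP[j _ ->]; have [? ?] := prI j; rewrite dvd1n.
Qed.

(** * Units of given multiplicative order *)

Section MultSieve.

Variable E : finFieldType.
Local Notation U := [set: {unit E}]%G.
Local Notation N := #|U|.

(** The units [u] with [u ^ d = 1]. *)
Definition unity_roots (d : nat) : {set {unit E}} := [set u | (u ^+ d)%g == 1%g].

Lemma unity_roots_group_set d : group_set (unity_roots d).
Proof.
apply/group_setP; split=> [|u v]; first by rewrite inE expg1n.
rewrite !inE => /eqP ud /eqP vd; rewrite expgMn ?ud ?vd ?mulg1 //.
by have /centsP := unit_abelian E; apply; rewrite inE.
Qed.

Canonical unity_roots_group d := group (unity_roots_group_set d).

(** The group of units is cyclic. *)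
Lemma card_unity_roots d : (d %| N)%N -> #|unity_roots d| = d.
Proof.
move=> d_N; have [g defU] := cyclicP (field_unit_group_cyclic U).
have Ng : N = #[g]%g by rewrite /= defU.
have d_gt0 : (0 < d)%N by apply: dvdn_gt0 d_N; rewrite cardG_gt0.
have N_gt0 : (0 < N)%N by rewrite cardG_gt0.
have -> : unity_roots d = <[g ^+ (N %/ d)]>%g.
  apply/setP=> u; rewrite inE; apply/eqP/idP => [ud | /cycleP[i ->]]; last first.
    by rewrite -!expgM mulnCA divnK // mulnC expgM Ng expg_order expg1n.
  have /cycleP[i ui] : u \in <[g]>%g by rewrite -defU inE.
  have : (N %| i * d)%N by rewrite Ng order_dvdn expgM -ui ud.
  rewrite -{1}(divnK d_N) dvdn_pmul2r // => /dvdnP[j ij].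
  by rewrite ui ij mulnC expgM mem_cycle.
by rewrite -orderE orderXdiv -Ng ?dvdn_divLR // ?divnA ?mulKn // dvdn_mulr.
Qed.

(** The sieve with [V0] the [M]-th roots of unity and [V l] the [M / l]-th ones,
    for [l] a prime factor of [M]. *)
Lemma mult_sieve (M r : nat) : (M * r)%N = N ->
  exists phi : 'CF(U), [/\ forall u, phi u != 0 ->
      (u ^+ M)%g = 1%g /\
      forall l, prime l -> (l %| M)%N -> (u ^+ (M %/ l))%g <> 1%g,
    '[phi, 'chi_0] = 1 &
    \sum_(i | i != 0) `|'[phi, 'chi_i]| <= (r * 2 ^ size (primes M))%:R - 1].
Proof.
move=> MrN; have M_N : (M %| N)%N by rewrite -MrN dvdn_mulr.
have M_gt0 : (0 < M)%N by apply: dvdn_gt0 M_N; rewrite cardG_gt0.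
pose V0 := unity_roots_group M.
pose I := (seq_sub (primes M) : finType).
pose V (i : I) := unity_roots_group (M %/ ssval i).
have prI (i : I) : prime (ssval i) /\ (ssval i %| M)%N.
  by have := ssvalP i; rewrite mem_primes => /and3P[].
have MlN l : (l %| M -> M %/ l %| N)%N.
  by move=> lM; apply: dvdn_trans (dvdn_div lM) M_N.
have sV0 : V0 \subset U by apply: subsetT.
have sV i : V i \subset V0.
  apply/subsetP=> u; rewrite !inE => /eqP ul; have [_ iM] := prI i.
  by rewrite -{1}(divnK iM) expgM ul expg1n.
have cardV0 : #|V0| = M by rewrite card_unity_roots.
have cardV i : #|V i| = (M %/ ssval i)%N.
  by rewrite card_unity_roots ?MlN //; case: (prI i).
have indexV i : #|V0 : V i| = ssval i.
  have [pr_i iM] := prI i.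
  by rewrite -divgS // cardV0 cardV divnA // mulKn.
have index_gt1 i : (1 < #|V0 : V i|)%N by rewrite indexV prime_gt1 //; case: (prI i).
have index_cap (S : {set I}) :
  (#|V0 :&: \bigcap_(i in S) V i| * \prod_(i in S) #|V0 : V i|)%N = #|V0|.
  rewrite [X in (_ * X)%N](eq_bigr _ (fun i _ => indexV i)).
  pose D := (\prod_(i in S) ssval i)%N.
  (* Taking [o = 1] in [dvdn_cap] leaves its first conclusion only. *)
  have D_M : (D %| M)%N.
    have [|t [uniq_t t_M Et]] := @prod_seq_sub _ S (fun=> True); first by [].
    rewrite /D Et; have [|//] := @dvdn_cap M 1 t uniq_t M_gt0 (dvd1n _).
    by move=> l /t_M[]; rewrite mem_primes => /and3P[-> _ ->] _; rewrite dvd1n.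
  suff -> : V0 :&: \bigcap_(i in S) V i = unity_roots (M %/ D) :> {set _}.
    by rewrite card_unity_roots ?MlN // divnK.
  apply/setP=> u; rewrite inE; apply/andP/idP => [[V0u /bigcapP Vu] | uD].
    have [|t [uniq_t t_M Et]] := @prod_seq_sub _ S (fun l => #[u]%g %| M %/ l)%N.
      by move=> i iS; have := Vu i iS; rewrite inE order_dvdn.
    rewrite inE -order_dvdn /D Et; have [||//] := @dvdn_cap M #[u]%g t uniq_t M_gt0.
      by rewrite order_dvdn; move: V0u; rewrite inE.
    by move=> l /t_M[]; rewrite mem_primes => /and3P[-> _ ->].
  move: uD; rewrite inE -order_dvdn => uD; split.
    by rewrite inE -order_dvdn (dvdn_trans uD) // dvdn_div.
  apply/bigcapP=> i iS; rewrite inE -order_dvdn (dvdn_trans uD) //.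
  have iD : (ssval i %| D)%N by rewrite /D (bigD1 i) //= dvdn_mulr.
  exact: dvdn_div2l.
have ab := unit_abelian E.
exists (sieve_cfun U V0 V); split.
- move=> u /(sieve_cfun_supp ab sV0 sV index_gt1)[]; rewrite inE => /eqP uM uV.
  split=> // l pr_l l_M; have lI : l \in primes M by rewrite mem_primes pr_l M_gt0.
  by have := uV (SeqSub lI); rewrite inE /= => /eqP.
- exact: cfdot_sieve_cfun1.
have := sieve_cfun_norm ab sV0 sV index_gt1 index_cap.
by rewrite -divgS // cardV0 -MrN mulKn // card_seq_sub ?primes_uniq.
Qed.

End MultSieve.

Lemma prim_root_of_order (R : fieldType) (a : R) (M : nat) : (0 < M)%N -> a ^+ M = 1 ->
  (forall l, prime l -> (l %| M)%N -> a ^+ (M %/ l) <> 1) -> M.-primitive_root a.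
Proof.
move=> M_gt0 aM al; have [m prim_m m_M] := prim_order_exists M_gt0 aM.
have [<- //|neq_mM] := eqVneq m M.
have m_gt0 := dvdn_gt0 M_gt0 m_M.
have Mm_gt1 : (1 < M %/ m)%N by rewrite ltn_divRL // mul1n ltn_neqAle neq_mM dvdn_leq.
have pr_l := pdiv_prime Mm_gt1; set l := pdiv _ in pr_l.
have l_Mm : (l %| M %/ m)%N by apply: pdiv_dvd.
have l_M : (l %| M)%N by apply: dvdn_trans l_Mm _; rewrite dvdn_div.
case: (al l pr_l l_M); apply/eqP; rewrite -(prim_order_dvd prim_m).
have /dvdnP[w Ew] := l_Mm.
by rewrite -(divnK m_M) Ew -mulnA mulnC -mulnA mulKn ?prime_gt0 // dvdn_mulr.
Qed.

(** * Existence *)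

(** The hypothesis on real powers, multiplied by [q^k] and squared. *)
Lemma powR_bound_nat (R : realType) (q n k m : nat) : (0 < q)%N ->
  m%:R <= (q%:R : R) `^ (n%:R / 2 - k%:R) -> ((m * q ^ k) ^ 2 <= q ^ n)%N.
Proof.
move=> q_gt0 le_m; have q0 : (q%:R : R) != 0 by rewrite pnatr_eq0 -lt0n.
have qq_ge0 : 0 <= (q%:R : R) by apply: ler0n.
have sq : ((q%:R : R) `^ (n%:R / 2)) ^+ 2 = q%:R ^+ n.
  by rewrite -[LHS]powR_mulrn ?powR_ge0 // -powRrM divfK ?pnatr_eq0 // powR_mulrn.
rewrite -(ler_nat R) !natrX -sq ler_pXn2r ?nnegrE ?powR_ge0 ?ler0n //.
rewrite natrM natrX -(subrK k%:R (n%:R / 2)) powRD ?q0 ?implybT // powR_mulrn //.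
by rewrite ler_wpM2r // exprn_ge0.
Qed.

Theorem theorem3p2 (R : realType) (q n : nat) (F : finFieldType)
    (L : fieldExtType F) (r k : nat) (f : {poly F})
    (cardF : #|F| = q) (n_gt0 : (0 < n)%N) (dimL : \dim {:L} = n)
    (r_dvd : (r %| q ^ n - 1)%N)
    (f_monic : f \is monic) (f_dvd : f %| 'X^n - 1) (f_deg : size f = k.+1)
    (hq : (q%:R : R) `^ (n%:R / 2 - k%:R) >=
          r%:R * (W_nat (q ^ n - 1))%:R * (W_poly (('X^n - 1) %/ f))%:R) :
  exists a : L, r_primitive r a /\ k_normal k a.
Proof.
subst q n.
have q_gt1 : (1 < #|F|)%N := finNzRing_gt1 F.
set q := #|F| in hq r_dvd q_gt1 *; set n := \dim {:L} in hq r_dvd f_dvd n_gt0 *.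
set h := _ %/ f in hq.
have fh : f * h = 'X^n - 1 by rewrite mulrC divpK.
have N_gt0 : (0 < q ^ n - 1)%N by rewrite subn_gt0 -{1}(expn0 q) ltn_exp2l.
have r_gt0 : (0 < r)%N := dvdn_gt0 N_gt0 r_dvd.
pose M := ((q ^ n - 1) %/ r)%N.
have MrN : (M * r = q ^ n - 1)%N by rewrite divnK.
have M_N : (M %| q ^ n - 1)%N by rewrite -MrN dvdn_mulr.
have M_gt0 := dvdn_gt0 N_gt0 M_N.
have nz_h : h != 0.
  apply: contraTneq (monicXnsubC (1 : F) n_gt0) => h0.
  by rewrite -fh h0 mulr0 monicE lead_coef0 eq_sym oner_eq0.
pose E : finFieldType := finvect_type L.
have cardE : #|E| = (q ^ n)%N.
  rewrite -(card_vspace_set fullv) -cardsT.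
  by apply: eq_card => x; rewrite !inE memvf.
have cardU : #|[set: {unit E}]%G| = (q ^ n - 1)%N.
  by rewrite card_finField_unit cardE subn1.
have [phi [phi_supp phi0 phi_norm]] := mult_sieve (etrans MrN (esym cardU)).
have [psi [psi_supp psi0 psi_norm]] := add_sieve fh f_monic.
pose a := (r * 2 ^ size (primes M))%N.
pose b := (q ^ k * 2 ^ #|{: irr_factor h}|)%N.
have bound : ((r * W_nat (q ^ n - 1) * W_poly h * q ^ k) ^ 2 <= q ^ n)%N.
  by apply: (powR_bound_nat (ltnW q_gt1)); rewrite 2!natrM; exact: hq.
have ab_le : ((a * b) ^ 2 <= #|E|)%N.
  rewrite cardE; apply: leq_trans bound; rewrite leq_exp2r //.
  rewrite mulnCA mulnC leq_mul2r; apply/orP; right.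
  by rewrite leq_mul ?W_poly_ge // leq_mul ?W_nat_ge.
(* If [h = 1] then [k = n], and the bound would read [(c * q^n)^2 <= q^n] with
   [c > 0]. *)
have h_neq1 : h != 1.
  apply: contraTneq bound => h1; rewrite -ltnNge.
  have nk : n = k.
    by apply/eqP; rewrite -eqSS -f_deg -(size_XnsubC (1 : F) n_gt0) -fh h1 mulr1.
  have W_gt0 : (0 < r * W_nat (q ^ n - 1) * W_poly h)%N.
    rewrite !muln_gt0 r_gt0 (leq_trans _ (W_nat_ge N_gt0 M_N)) ?expn_gt0 //=.
    by rewrite (leq_trans _ (W_poly_ge nz_h)) ?expn_gt0.
  rewrite -nk; apply: (@leq_trans ((q ^ n) ^ 2)); last first.
    by rewrite leq_exp2r // leq_pmull.
  by rewrite -{1}(expn1 (q ^ n)) ltn_exp2l // -{1}(expn0 q) ltn_exp2l.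
rewrite f_deg /= in psi_norm.
have a_gt0 : (0 < a)%N by rewrite muln_gt0 r_gt0 expn_gt0.
have b_gt0 : (0 < b)%N by rewrite muln_gt0 !expn_gt0 ltnW.
have [u [phi_u psi_u]] :=
  common_support a_gt0 b_gt0 ab_le phi0 psi0 phi_norm psi_norm.
have [uM ul] := phi_supp u phi_u; have [uh up] := psi_supp _ psi_u.
exists (FinRing.uval u : L); split; last first.
  have := k_normal_linpoly_ker fh f_monic uh up h_neq1; by rewrite f_deg.
rewrite /r_primitive -/q -/n r_dvd /=; apply: prim_root_of_order => //.
  by have := congr1 (@FinRing.uval E) uM; rewrite val_unitX.
move=> l pr_l l_M ul1; apply: (ul l pr_l l_M); apply/val_inj.
by rewrite /= val_unitX.
Qed.
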